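(* Let $S\subseteq (0,1)$ be a nonempty set. Then there exist a maximal $\mathsf{d}$-independent family $\mathcal{A}$ of cardinality $\mathfrak{c}$ and an at most countable subfamily $\mathcal{B}\subseteq \mathcal{A}$ such that $$\mathsf{d}[\mathcal{A}\setminus \mathcal{B}]=S \qquad\text{and}\qquad \mathsf{d}[\mathcal{B}]'\subseteq \{0,1\}.$$
   Context: Let $\omega=\{0,1,2,\ldots\}$ and identify $n\in\omega$ with $\{0,\ldots,n-1\}$. $\mathcal{D}$ is the family of all $A\subseteq\omega$ for which the asymptotic density $\mathsf{d}(A):=\lim_{n\to\infty}|A\cap n|/n$ exists. For $\mathcal{A}\subseteq\mathcal{P}(\omega)$, $\langle\mathcal{A}\rangle$ denotes the field of subsets of $\omega$ generated by $\mathcal{A}$. For $\mathcal{F}\subseteq\mathcal{D}$, $\mathsf{d}[\mathcal{F}]:=\{\mathsf{d}(A):A\in\mathcal{F}\}$. A nonempty family $\mathcal{A}\subseteq\mathcal{D}$ is $\mathsf{d}$-independent if: (1) $\mathsf{d}(A)\in(0,1)$ for all $A\in\mathcal{A}$; (2) $\langle\mathcal{A}\rangle\subseteq\mathcal{D}$; (3) $\mathsf{d}(\bigcap\mathcal{F})=\prod_{A\in\mathcal{F}}\mathsf{d}(A)$ for every nonempty finite $\mathcal{F}\subseteq\mathcal{A}$. It is a maximal $\mathsf{d}$-independent family if it is $\mathsf{d}$-independent and not properly contained in another $\mathsf{d}$-independent family. For $X\subseteq\mathbb{R}$, $X'$ denotes the set of accumulation points of $X$ in $\mathbb{R}$. $\mathfrak{c}=2^{\aleph_0}$.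 *)

(* Defs.v *)
From HB Require Import structures.
From mathcomp Require Import all_boot all_order all_algebra finmap.
From mathcomp Require Import all_classical all_reals all_analysis.

Set Implicit Arguments.
Unset Strict Implicit.
Unset Printing Implicit Defensive.

Import Order.TTheory GRing.Theory Num.Theory.
Import numFieldNormedType.Exports.

Local Open Scope classical_set_scope.
Local Open Scope ring_scope.

(* |A ∩ n| / n; at n = 0 this is 0 / 0 = 0, which does not affect the limit. *)
Definition density_ratio (R : realType) (A : set nat) (n : nat) : R :=
  #|` fset_set (A `&` `I_n)|%:R / n%:R.

Definition has_density (R : realType) : set (set nat) :=
  [set A | cvgn (density_ratio R A)].

(* Only meaningful when [has_density R A]; otherwise [lim] is a default value. *)
Definition density (R : realType) (A : set nat) : R :=
  limn (density_ratio R A).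

Definition field_of_sets (T : Type) (G : set (set T)) : Prop :=
  [/\ G set0, setU_closed G & setC_closed G].

Definition generated_field (T : Type) (G : set (set T)) : set (set T) :=
  smallest (@field_of_sets T) G.

Definition d_independent (R : realType) (A : set (set nat)) : Prop :=
  [/\ A !=set0 /\ A `<=` has_density R,
      (forall X, A X -> 0 < density R X < 1),
      generated_field A `<=` has_density R
    & forall F : set (set nat), finite_set F -> F !=set0 -> F `<=` A ->
        density R (\bigcap_(X in F) X) = \big[*%R/1]_(X \in F) density R X].

Definition maximal_d_independent (R : realType) (A : set (set nat)) : Prop :=
  d_independent R A /\
  ~ exists B : set (set nat), d_independent R B /\ A `<` B.

(* Main.v *)
Require Import Defs.
From HB Require Import structures.
From mathcomp Require Import all_boot all_order all_algebra finmap.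
From mathcomp Require Import all_classical all_reals all_analysis.
From mathcomp Require Import ring lra zify.

(* Let [A] be maximal, by Zorn, among the independent families with all
   densities in [S], starting from one of cardinality continuum whose set of
   densities is exactly [S], and extend [A] to a maximal independent family [M];
   put [B = M \ A]. If infinitely many members [X_k] of [B] had their density
   in [[e, 1 - e]], then the field generated by the [X_k] would be atomless: for
   [s] in [S], a greedy choice of atoms of this field has as its union a set
   [Y], sandwiched between members of the field of density arbitrarily close to
   [s], hence of density [s] and independent of [A]. This contradicts the
   maximality of [A]. Thus [B] is countable and its densities accumulate only at
   0 and 1. *)

Import Order.TTheory GRing.Theory Num.Theory.
Import numFieldNormedType.Exports.

Local Open Scope classical_set_scope.
Local Open Scope card_scope.
Local Open Scope ring_scope.

Set Implicit Arguments.
Unset Strict Implicit.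

(** * Rules of computation for asymptotic density *)

Lemma setU1D1 (T : Type) (x : T) (F : set T) : ~ F x -> (x |` F) `\ x = F.
Proof.
move=> Fx; rewrite setDUl setDv set0U setDidl // -subset0 => y [Fy yx].
by apply: Fx; rewrite -yx.
Qed.

Lemma setID_distrl (T : Type) (W V I : set T) :
  (W `\` V) `&` I = (W `&` I) `\` (V `&` I).
Proof.
apply/seteqP; split=> x [[Wx +]] => [Vx Ix|Ix VIx]; split=> //; first by case.
by split=> // Vx; exact: VIx.
Qed.

(** Carries existence and value of the density together, whereas [density] alone takes a default
    value where the limit fails to exist. *)
Definition density_to (R : realType) (A : set nat) (a : R) : Prop :=
  density_ratio R A @ \oo --> a.

Lemma density_ratioE (R : realType) (A : set nat) (n : nat) :
  density_ratio R A n = (\sum_(i < n) (val i \in A)%:R) / n%:R.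
Proof.
congr (_ / _); elim: n => [|n IHn].
  by rewrite big_ord0 II0 setI0 fset_set0 cardfs0.
rewrite big_ord_recr /= -IHn IIS setIUr.
have [nA|nA] := boolP (n \in A).
  have -> : A `&` [set n] = [set n].
    by apply: setIidr => _ ->; rewrite -inE.
  rewrite setUC fset_setU1; last exact: finite_setIr.
  have nAn : n \notin fset_set (A `&` `I_n).
    rewrite in_fset_set; last exact: finite_setIr.
    by apply/negP => /set_mem[_ /=]; rewrite ltnn.
  by rewrite cardfsU1 nAn natrD addrC.
rewrite addr0; congr (#|` fset_set _|%:R).
rewrite setUidl // => k [Ak /= kn]; case/negP: nA.
by rewrite inE -kn.
Qed.

Lemma density_to_density (R : realType) (A : set nat) (a : R) :
  density_to A a -> density R A = a.
Proof. exact: cvg_lim. Qed.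

Lemma density_to_has_density (R : realType) (A : set nat) (a : R) :
  density_to A a -> has_density R A.
Proof. by move=> Aa; apply/cvg_ex; exists a. Qed.

Lemma has_densityP (R : realType) (A : set nat) :
  has_density R A -> density_to A (density R A).
Proof. by []. Qed.

Lemma density_toT (R : realType) : density_to setT (1 : R).
Proof.
apply: cvg_near_cst; near=> n; apply/eqP.
rewrite density_ratioE (eq_bigr (fun=> 1)) => [|i _]; last by rewrite in_setT.
rewrite sumr_const card_ord divff // pnatr_eq0 -lt0n.
by near: n; exact: nbhs_infty_gt.
Unshelve. all: by end_near. Qed.

Lemma density_toD (R : realType) (A B : set nat) (a b : R) :
  B `<=` A -> density_to A a -> density_to B b -> density_to (A `\` B) (a - b).
Proof.
move=> BA Aa Bb; rewrite /density_to.
suff -> : density_ratio R (A `\` B) = density_ratio R A \- density_ratio R B.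
  exact: cvgB.
apply/funext => n; rewrite /= !density_ratioE -mulrBl -sumrB; congr (_ / _).
apply: eq_bigr => i _; rewrite in_setD.
have [iB|iB] := boolP (_ \in B); last by rewrite andbT subr0.
by rewrite (mem_set (BA _ (set_mem iB))) subrr.
Qed.

Lemma density_toU (R : realType) (A B : set nat) (a b : R) :
  A `&` B = set0 -> density_to A a -> density_to B b ->
  density_to (A `|` B) (a + b).
Proof.
move=> AB Aa Bb; rewrite /density_to.
suff -> : density_ratio R (A `|` B) = density_ratio R A \+ density_ratio R B.
  exact: cvgD.
apply/funext => n; rewrite /= !density_ratioE -mulrDl -big_split /=.
congr (_ / _); apply: eq_bigr => i _; rewrite in_setU.
have [iA|_] := boolP (_ \in A); have [iB|_] := boolP (_ \in B);
  rewrite ?addr0 ?add0r //.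
suff : (A `&` B) i by rewrite AB.
by split; exact: set_mem.
Qed.

Lemma le_density_ratio (R : realType) (A B : set nat) (n : nat) :
  A `<=` B -> density_ratio R A n <= density_ratio R B n.
Proof.
move=> AB; rewrite !density_ratioE ler_wpM2r ?invr_ge0 ?ler0n //.
apply: ler_sum => i _; rewrite ler_nat.
by have [/set_mem/AB/mem_set->|] := boolP (_ \in A).
Qed.

(** Used for infinite unions, on which density is not additive: the ratio of [A] lies between those
    of [B] and [C], eventually within [e / 2] of [b] and [c]. *)
Lemma density_to_squeeze (R : realType) (A : set nat) (a : R) :
  (forall e, 0 < e -> exists B C b c,
    [/\ B `<=` A, A `<=` C, density_to B b & density_to C c] /\
    a - e <= b /\ c <= a + e) ->
  density_to A a.
Proof.
move=> sq; apply/cvgrPdist_le => e e0.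
have e20 : 0 < e / 2 by rewrite divr_gt0.
have [B [C [b [c [[BA AC Bb Cc] [ab ca]]]]]] := sq _ e20.
move/cvgrPdist_le : Bb => /(_ _ e20) Bb.
move/cvgrPdist_le : Cc => /(_ _ e20) Cc.
near=> n.
have : `|b - density_ratio R B n| <= e / 2 by near: n.
have : `|c - density_ratio R C n| <= e / 2 by near: n.
have := le_density_ratio R n BA; have := le_density_ratio R n AC.
rewrite !ler_norml; set x := density_ratio R A n.
move: (density_ratio R B n) (density_ratio R C n) => u v.
by move=> ? ? /andP[? ?] /andP[? ?]; lra.
Unshelve. all: by end_near. Qed.

(** * The product formula relative to a family *)

(** The empty [F] is allowed and yields the density of [W] itself; with [W = setT] and [w = 1] this
    is the product formula for [G]. *)
Definition indep_over (R : realType) (G : set (set nat)) (W : set nat) (w : R) :=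
  forall F : set (set nat), finite_set F -> F `<=` G ->
    density_to (W `&` \bigcap_(X in F) X) (w * \big[*%R/1]_(X \in F) density R X).

Lemma indep_overS (R : realType) (G G' : set (set nat)) (W : set nat) (w : R) :
  G' `<=` G -> indep_over G W w -> indep_over G' W w.
Proof. by move=> G'G GW F finF FG'; apply: GW => //; exact: subset_trans G'G. Qed.

Lemma indep_over_density_to (R : realType) (G : set (set nat)) (W : set nat) (w : R) :
  indep_over G W w -> density_to W w.
Proof.
move=> GW; have := GW set0 (finite_set0 _) (@sub0set _ _).
by rewrite bigcap_set0 setIT fsbig_set0 mulr1.
Qed.

Lemma indep_overU (R : realType) (G : set (set nat)) (V W : set nat) (v w : R) :
  V `&` W = set0 -> indep_over G V v -> indep_over G W w ->
  indep_over G (V `|` W) (v + w).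
Proof.
move=> VW GV GW F finF FG; rewrite setIUl mulrDl.
by apply: density_toU; [rewrite setIACA VW set0I | exact: GV | exact: GW].
Qed.

Lemma indep_overD (R : realType) (G : set (set nat)) (V W : set nat) (v w : R) :
  V `<=` W -> indep_over G V v -> indep_over G W w ->
  indep_over G (W `\` V) (w - v).
Proof.
move=> VW GV GW F finF FG; rewrite mulrBl setID_distrl.
by apply: density_toD; [exact: setSI | exact: GW | exact: GV].
Qed.

Lemma indep_overI (R : realType) (G : set (set nat)) (W X : set nat) (w : R) :
  indep_over G W w -> G X -> indep_over (G `\ X) (W `&` X) (w * density R X).
Proof.
move=> GW GX F finF FG.
have XF : finite_set (X |` F) by rewrite finite_setU.
have := GW (X |` F) XF; rewrite bigcap_setU1 setIA (fsbigD1 X) ?mulrA; last 2 first.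
  exact: XF.
  by left.
by rewrite setU1D1; [apply=> Y [->//|/FG[]] | move=> /FG[_]; apply].
Qed.

(** The range [D] of densities is a parameter because maximality is taken once with [D = S] and once
    with the open unit interval. *)
Definition independent (R : realType) (D : set R) (G : set (set nat)) : Prop :=
  (forall X, G X -> D (density R X)) /\ indep_over G setT (1 : R).

Lemma finite_set_ind (T : choiceType) (P : set T -> Prop) :
  P set0 ->
  (forall x F, finite_set F -> ~ F x -> P F -> P (x |` F)) ->
  forall F, finite_set F -> P F.
Proof.
move=> P0 PU F /finite_fsetP[X ->]; elim/finSet_rect: X => X IHX.
have [->|[x xX]] := fset_0Vmem X; first by rewrite set_fset0.
rewrite -(fsetD1K xX) set_fsetU set_fset1; apply: PU => //.
  by rewrite /= !inE eqxx.
by apply: IHX; exact: fproperD1.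
Qed.

Lemma generated_field_bigcap (T : choiceType) (G F : set (set T)) :
  finite_set F -> F `<=` G -> generated_field G (\bigcap_(X in F) X).
Proof.
move=> + + K [[K0 KU KC] GK].
elim/finite_set_ind => [_|X {}F finF FX IHF XFG].
  by rewrite bigcap_set0 -setC0; exact: KC.
rewrite bigcap_setU1 -[_ `&` _]setCK setCI; apply/KC/KU; apply: KC.
  by apply/GK/XFG; left.
by apply: IHF => Y FY; apply: XFG; right.
Qed.

(* The sets [E] such that intersecting with [E] preserves the property "has a
   density along every finite intersection of members of [G]" form a field;
   this avoids disjunctive normal forms for the elements of [<G>]. *)
Lemma generated_field_has_density (R : realType) (G : set (set nat)) :
  indep_over G setT (1 : R) -> generated_field G `<=` has_density R.
Proof.
move=> indG.
pose good W := forall F, finite_set F -> F `<=` G ->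
  has_density R (W `&` \bigcap_(X in F) X).
have goodD V W : V `<=` W -> good V -> good W -> good (W `\` V).
  move=> VW gV gW F finF FG; rewrite setID_distrl.
  by apply/density_to_has_density/density_toD;
    [exact: setSI|apply/has_densityP/gW|apply/has_densityP/gV].
pose K := [set E | forall W, good W -> good (W `&` E)].
have KC : setC_closed K.
  move=> E KE W gW; have -> : W `&` ~` E = W `\` (W `&` E).
    apply/seteqP; split=> x [Wx Ex]; split=> //; first by case.
    by move=> Ex'; exact: Ex.
  by apply: goodD => //; exact: KE.
have KI A B : K A -> K B -> K (A `&` B).
  by move=> KA KB W gW; rewrite setIA; exact/KB/KA.
have fieldK : field_of_sets K.
  split; last exact: KC.
    move=> W gW F finF FG; rewrite setI0 set0I -(setDv setT).
    apply/density_to_has_density/density_toD; first exact: subset_refl.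
      exact: density_toT.
    exact: density_toT.
  by move=> A B KA KB; rewrite -[A `|` B]setCK setCU; apply/KC/KI; exact: KC.
have GK : G `<=` K.
  move=> X GX W gW F finF FG; rewrite -setIA -bigcap_setU1; apply: gW.
    by rewrite finite_setU.
  by move=> Y [->|/FG].
move=> E /(_ K (conj fieldK GK)) /(_ setT) KE.
have := KE _ set0 (finite_set0 _) (@sub0set _ _).
rewrite bigcap_set0 setIT setTI; apply => F finF FG.
exact: density_to_has_density (indG _ finF FG).
Qed.

Lemma d_independentP (R : realType) (G : set (set nat)) :
  d_independent R G <-> G !=set0 /\ independent [set x : R | 0 < x < 1] G.
Proof.
split=> [[[G0 Gdens] G01 fieldG indG]|[G0 [G01 indG]]].
  split=> //; split=> // F finF FG; rewrite setTI mul1r.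
  have [->|/set0P F0] := eqVneq F set0.
    by rewrite bigcap_set0 fsbig_set0; exact: density_toT.
  rewrite -indG //; apply/has_densityP/fieldG.
  exact: generated_field_bigcap.
have fieldG := generated_field_has_density indG.
split=> //.
  by split=> // X GX; apply: fieldG => K [_]; exact.
move=> F finF _ FG; apply: density_to_density.
by have := indG F finF FG; rewrite setTI mul1r.
Qed.

(** * Maximal families by Zorn's lemma *)

Lemma independentS (R : realType) (D D' : set R) (G G' : set (set nat)) :
  D `<=` D' -> G' `<=` G -> independent D G -> independent D' G'.
Proof.
move=> DD' G'G [GD indG]; split; last exact: indep_overS indG.
by move=> X /G'G/GD/DD'.
Qed.

Lemma independent_finite (R : realType) (D : set R) (G : set (set nat)) :
  (forall F, finite_set F -> F `<=` G -> independent D F) -> independent D G.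
Proof.
move=> finG; split=> [X GX|F finF FG].
  have X1G : [set X] `<=` G by move=> _ ->.
  by apply: (finG _ (finite_set1 X) X1G).1.
exact: (finG F finF FG).2.
Qed.

(** Zorn's lemma is applied to the [G] with [Q (G0]|[G)], so that the empty chain is bounded too. A
    finite subset of the union of a chain lies, up to [G0], in a single member. *)
Lemma finite_character_maximal (T : choiceType) (Q : set (set T)) :
  (forall G, (forall F, finite_set F -> F `<=` G -> Q F) -> Q G) ->
  (forall G G', G `<=` G' -> Q G' -> Q G) ->
  forall G0, Q G0 ->
  exists G, [/\ G0 `<=` G, Q G & forall H, G `<=` H -> Q H -> H `<=` G].
Proof.
move=> Qfin Qsub G0 QG0.
have chain (C : set (set T)) : C `<=` [set G | Q (G0 `|` G)] ->
    total_on C subset -> Q (G0 `|` \bigcup_(G in C) G).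
  move=> CQ Ctot; apply: Qfin => F finF FG0C.
  (* The left alternative serves the empty chain, which has no member to offer. *)
  suff [FG0|[G CG FG]] : F `<=` G0 \/ exists2 G, C G & F `<=` G0 `|` G.
    by apply: Qsub FG0 _.
    by apply: Qsub FG _; exact: CQ.
  move: FG0C; elim/finite_set_ind: F / finF => [_|x F finF Fx IHF]; first by left.
  rewrite subUset => -[x1 /IHF{IHF} IHF].
  have {x1} [G0x|[H CH Hx]] := x1 x erefl.
    case: IHF => [FG0|[G CG FG]]; [left|right].
      by rewrite subUset; split=> // _ ->.
    by exists G => //; rewrite subUset; split=> // _ ->; left.
  right; case: IHF => [FG0|[G CG FG]].
    exists H => //; rewrite subUset; split=> [_ ->|]; first by right.
    by apply: subset_trans FG0 _; left.
  have [GH|HG] := Ctot G H CG CH.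
    exists H => //; rewrite subUset; split=> [_ ->|]; first by right.
    by apply: subset_trans FG _; exact: setUS.
  exists G => //; rewrite subUset; split=> // _ ->; right; exact: HG.
have [G [QG maxG]] := Zorn_bigcup chain.
exists (G0 `|` G); split=> // H GH QH y Hy; apply: contrapT => Gy.
apply: (maxG H); last first.
  by apply: Qsub QH; rewrite subUset; split=> // z G0z; apply: GH; left.
split; first by move=> z Gz; apply: GH; right.
by move=> /(_ y Hy) Gy'; apply: Gy; right.
Qed.

Lemma independent_maximal (R : realType) (D : set R) (G0 : set (set nat)) :
  independent D G0 ->
  exists G, [/\ G0 `<=` G, independent D G &
    forall H, G `<=` H -> independent D H -> H `<=` G].
Proof.
apply: (finite_character_maximal (Q := independent D)) => [G|G G' GG'].
  exact: independent_finite.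
exact: independentS.
Qed.

(** * Greedy construction of a set of prescribed density *)

(** The sets built in the first [n] steps depend on the first [n] terms of [X], so the product
    formula is kept only over [A] and the later terms. *)
Definition indep_tail (A : set (set nat)) (X : nat -> set nat) (n : nat) :=
  A `|` X @` [set k | (n <= k)%N].

(* [Y] is the part already chosen, [D] the part still undecided: a single atom
   of the field generated by the first [n] sets. *)
Record greedy_state (R : realType) :=
  Greedy { gY : set nat; gD : set nat; gy : R; gd : R }.

(** If the half of [gD g] inside [X] fits below [s], it is chosen and the other half stays
    undecided; if not, it stays undecided and the other half is rejected for good. The difference is
    written with [gD g]&[X] to match the inclusion required by [indep_overD]. *)
Definition greedy_step (R : realType) (s : R) (X : set nat)
    (g : greedy_state R) : greedy_state R :=
  let x := density R X in
  if gy g + gd g * x <= s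
  then Greedy (gY g `|` (gD g `&` X)) (gD g `\` (gD g `&` X))
         (gy g + gd g * x) (gd g - gd g * x)
  else Greedy (gY g) (gD g `&` X) (gy g) (gd g * x).

Fixpoint greedy (R : realType) (s : R) (X : nat -> set nat) (n : nat) :
    greedy_state R :=
  if n is n'.+1 then greedy_step s (X n') (greedy s X n')
  else Greedy set0 setT 0 1.

Lemma greedy_indep (R : realType) (s : R) (A : set (set nat))
    (X : nat -> set nat) (n : nat) :
  injective X -> (forall k, ~ A (X k)) ->
  indep_over (A `|` range X) setT (1 : R) ->
  [/\ gY (greedy s X n) `&` gD (greedy s X n) = set0,
      indep_over (indep_tail A X n) (gY (greedy s X n)) (gy (greedy s X n))
    & indep_over (indep_tail A X n) (gD (greedy s X n)) (gd (greedy s X n))].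
Proof.
move=> Xinj AX indAX.
elim: n => [|n [+ + +]] /=.
  have sub : indep_tail A X 0 `<=` A `|` range X.
    by move=> Z [AZ|[k _ <-]]; [left|right; exists k].
  have indT := indep_overS sub indAX.
  split=> //; first by rewrite set0I.
  by have := indep_overD (@subset_refl _ setT) indT indT; rewrite setDv subrr.
case: (greedy s X n) => Y D y d /= YD indY indD.
have sub : indep_tail A X n.+1 `<=` indep_tail A X n `\ X n.
  move=> Z [AZ|[k /= nk <-]]; split.
  - by left.
  - by move=> /= ZX; apply: (AX n); rewrite -ZX.
  - by right; exists k => //=; exact: ltnW.
  - by move=> /= /Xinj kn; rewrite kn ltnn in nk.
have tailX : indep_tail A X n (X n) by right; exists n => /=.
have subn : indep_tail A X n.+1 `<=` indep_tail A X n.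
  by apply: subset_trans sub _; exact: subDsetl.
have indDX := indep_overS sub (indep_overI indD tailX).
have {}indY := indep_overS subn indY; have {}indD := indep_overS subn indD.
rewrite /greedy_step /=; case: ifP => _ /=; split=> //.
- apply/seteqP; split=> // k [[Yk|DXk] [Dk nDX]]; last by case: nDX.
  by rewrite -YD; split.
- apply: indep_overU => //; rewrite setIA YD; exact: set0I.
- by apply: indep_overD => //; exact: subIsetl.
- by rewrite setIA YD set0I.
Qed.

(** The target [s] stays between the chosen mass and the chosen plus undecided mass. Each step
    multiplies the undecided mass by the density of [X n] or its complement to 1, both at most
    [1 - e]. *)
Lemma greedy_bound (R : realType) (s e : R) (X : nat -> set nat) (n : nat) :
  0 <= s <= 1 -> 0 < e -> (forall k, e <= density R (X k) <= 1 - e) ->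
  let g := greedy s X n in gy g <= s <= gy g + gd g /\ 0 <= gd g <= (1 - e) ^+ n.
Proof.
move=> s01 e0 Xe; elim: n => [|n] /=; first by rewrite expr0 add0r ler01 lexx.
case: (greedy s X n) => Y D y d /= [/andP[ys syd] /andP[d0 de]].
have /andP[eX Xe1] := Xe n.
rewrite /greedy_step /= exprS; set x := density R (X n) in eX Xe1 *.
have e1 : 0 <= 1 - e by apply: le_trans Xe1; apply: le_trans eX; exact: ltW.
have le_c z : z <= 1 - e -> d * z <= (1 - e) * (1 - e) ^+ n.
  move=> ze; apply: (@le_trans _ _ (d * (1 - e))); first exact: ler_wpM2l.
  by rewrite mulrC ler_wpM2l.
have dx : d * x <= (1 - e) * (1 - e) ^+ n by exact: le_c.
have dx' : d - d * x <= (1 - e) * (1 - e) ^+ n.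
  by rewrite -{1}[d]mulr1 -mulrBr; apply: le_c; lra.
have dx0 : 0 <= d * x by apply: mulr_ge0 => //; lra.
have dx1 : 0 <= d - d * x.
  by rewrite -{1}[d]mulr1 -mulrBr; apply: mulr_ge0 => //; lra.
case: ifPn => /=; rewrite -?ltNge => ?; split; apply/andP; split=> //; lra.
Qed.

(** The chosen parts increase, while chosen plus undecided parts decrease. Hence the union of all
    chosen parts lies below every chosen plus undecided part. *)
Lemma greedy_mono (R : realType) (s : R) (X : nat -> set nat) (m n : nat) :
  gY (greedy s X m) `<=` gY (greedy s X n) `|` gD (greedy s X n).
Proof.
have step k : gY (greedy s X k) `<=` gY (greedy s X k.+1) /\
    gY (greedy s X k.+1) `|` gD (greedy s X k.+1) `<=`
    gY (greedy s X k) `|` gD (greedy s X k).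
  rewrite /= /greedy_step; case: (greedy s X k) => Y D y d /=.
  case: ifP => _ /=; split; [| | exact: subset_refl |].
  - by move=> i; left.
  - by move=> i [[Yi|[Di _]]|[Di _]]; by [left|right].
  - by move=> i [Yi|[Di _]]; by [left|right].
have [mn|/ltnW nm] := leqP m n.
  apply: (@subset_trans _ (gY (greedy s X n))); last by move=> i; left.
  by rewrite -(subnKC mn); elim: (n - m)%N => [|k IH];
    rewrite ?addn0 // addnS; apply: subset_trans IH (step _).1.
apply: (@subset_trans _ (gY (greedy s X m) `|` gD (greedy s X m))).
  by move=> i; left.
by rewrite -(subnKC nm); elim: (m - n)%N => [|k IH];
  rewrite ?addn0 // addnS; apply: subset_trans (step _).2 IH.
Qed.

Lemma indep_over_prescribed (R : realType) (s e : R) (A : set (set nat))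
    (X : nat -> set nat) :
  0 <= s <= 1 -> 0 < e -> (forall k, e <= density R (X k) <= 1 - e) ->
  injective X -> (forall k, ~ A (X k)) ->
  independent [set x : R | 0 <= x <= 1] (A `|` range X) ->
  exists Y, indep_over A Y s.
Proof.
move=> s01 e0 Xe Xinj AX [AXD indAX].
pose g := greedy s X.
exists (\bigcup_n gY (g n)) => F finF FA.
set I := \bigcap_(Z in F) Z; set p := \big[*%R/1]_(Z \in F) density R Z.
have p01 : 0 <= p <= 1.
  rewrite /p; elim/finite_set_ind: F / finF FA @I @p => [_|Z F finF FZ IHF ZFA].
    by rewrite fsbig_set0 ler01 lexx.
  have /andP[Z0 Z1] : 0 <= density R Z <= 1.
    by apply: AXD; left; apply: ZFA; left.
  rewrite (fsbigD1 Z); last 2 first.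
  - by rewrite finite_setU.
  - by left.
  rewrite setU1D1 //.
  have /andP[p0 p1] := IHF (fun Y FY => ZFA Y (or_intror FY)).
  by rewrite mulr_ge0 //= mulr_ile1.
apply: density_to_squeeze => r r0.
have e1 : `|1 - e| < 1.
  by have /andP[] := Xe 0%N; rewrite ltr_norml => ? ?; apply/andP; split; lra.
have /cvgrPdist_lt/(_ _ r0) [n _ /(_ n (leqnn n))] := cvg_geometric 1 e1.
rewrite /= sub0r normrN mul1r => nr.
have [YD indY indD] := greedy_indep s n Xinj AX indAX.
have [/andP[ys syd] /andP[d0 de]] := greedy_bound n s01 e0 Xe.
have {de nr} dr : gd (g n) < r.
  by apply: le_lt_trans de _; apply: le_lt_trans (ler_norm _) nr.
have FT : F `<=` indep_tail A X n by move=> Z /FA; left.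
exists (gY (g n) `&` I), ((gY (g n) `|` gD (g n)) `&` I).
exists (gy (g n) * p), ((gy (g n) + gd (g n)) * p); split; first split.
- by apply: setSI => i Yi; exists n.
- by apply: setSI => i [m _]; exact: greedy_mono.
- exact: indY.
- exact: (indep_overU YD indY indD).
(* Multiplying by [p], which lies in the unit interval, does not enlarge the two gaps around [s];
   both are at most [gd (g n) < r]. *)
have /andP[p0 p1] := p01; rewrite -/(g n) in ys syd d0.
have : 0 <= (s - gy (g n)) * (1 - p) by apply: mulr_ge0; lra.
have : 0 <= (gy (g n) + gd (g n) - s) * (1 - p) by apply: mulr_ge0; lra.
by split; lra.
Qed.

(** * Adding a set to a maximal family *)

Lemma independentU1 (R : realType) (D : set R) (A : set (set nat))
    (Y : set nat) (s : R) :
  D s -> ~ A Y -> independent D A -> indep_over A Y s -> independent D (Y |` A).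
Proof.
move=> Ds AY [AD indA] indY.
have Ys : density R Y = s by exact: density_to_density (indep_over_density_to indY).
split=> [X [->|/AD//]|F finF FYA]; first by rewrite Ys.
have [FY|FY] := pselect (F Y); last first.
  by apply: indA => // X FX; have [XY|//] := FYA X FX; rewrite XY in FX.
rewrite -(setD1K FY) bigcap_setU1 (fsbigD1 Y); last 2 first.
- by rewrite setD1K.
- by left.
rewrite setD1K // setTI mul1r Ys; apply: indY; first exact: finite_setD.
by move=> X [FX XY]; have [|] := FYA X FX.
Qed.

(** A member of [A] would be independent of itself, giving [s = s * s]. *)
Lemma indep_over_notin (R : realType) (A : set (set nat)) (Y : set nat) (s : R) :
  0 < s < 1 -> indep_over A Y s -> ~ A Y.
Proof.
move=> /andP[s0 s1] indY AY.
have Ys := indep_over_density_to indY.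
have Y1 : [set Y] `<=` A by move=> _ ->.
have := density_to_density (indY [set Y] (finite_set1 _) Y1).
rewrite bigcap_set1 setIid fsbig_set1 (density_to_density Ys) => /eqP.
rewrite -{1}[s]mulr1 => /eqP /(mulfI (lt0r_neq0 s0)) s1'.
by rewrite -s1' ltxx in s1.
Qed.

(* Otherwise the infinitely many extra sets produce, by a greedy choice, a new
   set of density [s] independent of [A]. *)
Lemma maximal_extension_finite (R : realType) (S : set R)
    (A M : set (set nat)) (s e : R) :
  S `<=` [set x | 0 < x < 1] -> S s -> 0 < e ->
  independent S A ->
  (forall H, A `<=` H -> independent S H -> H `<=` A) ->
  A `<=` M -> independent [set x : R | 0 < x < 1] M ->
  finite_set [set X | (M `\` A) X /\ e <= density R X <= 1 - e].
Proof.
move=> S01 Ss e0 indA maxA AM indM; apply: contrapT => /infiniteP.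
case/pcard_leP => X.
have XP k : (M `\` A) (X k) /\ e <= density R (X k) <= 1 - e.
  by apply: (@funS _ _ setT _ X).
have Xinj : injective X by move=> k l; apply: (inj (f := X)); rewrite inE.
have /andP[s0 s1] := S01 s Ss.
have [|k|k||Y indY] := @indep_over_prescribed R s e A X _ e0 _ Xinj.
- by rewrite !ltW.
- by have [] := XP k.
- by have [[]] := XP k.
- apply: independentS indM => [x /andP[x0 x1]|Z [/AM//|[k _ <-]]].
    by rewrite /= !ltW.
  by have [[]] := XP k.
have AY : ~ A Y by apply: indep_over_notin indY; rewrite s0.
apply/AY/(maxA (Y |` A)); [by move=> Z; right | | by left].
exact: independentU1 indY.
Qed.

(** * Densities of slowly changing periodic sets *)

(** Full periods cancel; fewer than [L] terms of size at most 1 remain. *)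
Lemma periodic_sum_bounded (R : realDomainType) (h : nat -> R) (L : nat) :
  (0 < L)%N -> (forall n, h (L + n)%N = h n) -> \sum_(0 <= n < L) h n = 0 ->
  (forall n, `|h n| <= 1) ->
  forall N, `|\sum_(0 <= n < N) h n| <= L%:R.
Proof.
move=> L0 hL hL0 h1 N; elim/ltn_ind: N => N IHN.
have [NL|LN] := ltnP N L.
  apply: (@le_trans _ _ (\sum_(0 <= n < N) 1)).
    by apply: le_trans (ler_norm_sum _ _ _) _; exact: ler_sum.
  by rewrite sumr_const_nat subn0 ler_nat ltnW.
rewrite (big_cat_nat _ LN) //= hL0 add0r.
rewrite -{1}[L]add0n big_addn.
under eq_bigr do rewrite addnC hL.
by apply: IHN; rewrite ltn_subrL L0 (leq_trans L0).
Qed.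

(** Compare the sum up to [N] with the sum [H (lev N) N] that uses the current level throughout. The
    difference changes only when the level does. *)
Lemma slow_sum_bounded (R : realDomainType) (h : nat -> nat -> R)
    (L lev : nat -> nat) :
  (forall m N, `|\sum_(0 <= n < N) h m n| <= (L m)%:R) ->
  {homo lev : m n / (m <= n)%N} ->
  forall N, `|\sum_(0 <= n < N) h (lev n) n| <=
    (\sum_(j < (lev N).+1) 2 * L j)%:R.
Proof.
move=> hL lev_mono N.
pose H m n := \sum_(0 <= k < n) h m k.
(* A jump from level [a] to level [b] costs at most [L a + L b]; [Phi] is a potential that absorbs
   this cost, even when levels are skipped. *)
pose Phi m := ((\sum_(j < m) 2 * L j) + L m)%N.
have PhiS a b : (a < b)%N -> (Phi a + L a + L b <= Phi b)%N.
  move=> ab; rewrite /Phi.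
  have : (\sum_(j < a.+1) 2 * L j <= \sum_(j < b) 2 * L j)%N.
    by rewrite -(big_mkord xpredT (fun j => 2 * L j)%N)
      -(big_mkord xpredT (fun j => 2 * L j)%N) (@big_cat_nat _ _ _ a.+1 0 b) //=
      leq_addr.
  rewrite big_ord_recr /=; lia.
have key : `|\sum_(0 <= n < N) h (lev n) n - H (lev N) N| <= (Phi (lev N))%:R.
  elim: N => [|N IHN]; first by rewrite /H !big_geq // subrr normr0.
  rewrite big_nat_recr //=.
  have := lev_mono _ _ (leqnSn N); rewrite leq_eqVlt => /orP[/eqP <-|lt_lev].
    have -> : H (lev N) N.+1 = H (lev N) N + h (lev N) N by rewrite /H big_nat_recr.
    by rewrite opprD addrACA subrr addr0.
  have -> : \sum_(0 <= n < N) h (lev n) n + h (lev N) N - H (lev N.+1) N.+1 =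
      (\sum_(0 <= n < N) h (lev n) n - H (lev N) N) + H (lev N) N.+1
      - H (lev N.+1) N.+1.
    by rewrite /H [\sum_(0 <= k < N.+1) h (lev N) k]big_nat_recr //=; ring.
  move: (PhiS _ _ lt_lev) IHN (hL (lev N) N.+1) (hL (lev N.+1) N.+1).
  rewrite -!/(H _ _) -(ler_nat R) !natrD !ler_norml.
  move=> ? /andP[? ?] /andP[? ?] /andP[? ?]; apply/andP; split; lra.
rewrite -[\sum_(0 <= n < N) _](subrK (H (lev N) N)).
apply: le_trans (ler_normD _ _) _; apply: le_trans (lerD key (hL _ _)) _.
by rewrite -natrD ler_nat /Phi big_ord_recr /=; lia.
Qed.

(** Let [lev n] be the largest [m <= n] with [m * K m <= n]; the value 0 always qualifies. Then an
    error of size [K (lev n)] is at most [n / lev n], which is negligible against [n]. *)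
Lemma slow_levelP (K : nat -> nat) :
  exists lev : nat -> nat,
    [/\ {homo lev : m n / (m <= n)%N},
        forall M, exists N, forall n, (N <= n)%N -> (M <= lev n)%N
      & forall n, (lev n * K (lev n) <= n)%N].
Proof.
pose lev n := \max_(m < n.+1 | (m * K m <= n)%N) val m.
have le_lev m n : (m <= n)%N -> (m * K m <= n)%N -> (m <= lev n)%N.
  rewrite -ltnS => mn mK.
  exact: (@leq_bigmax_cond _ (fun i : 'I_n.+1 => i * K i <= n)%N val (Ordinal mn)).
have lev_attained n : (lev n <= n)%N /\ (lev n * K (lev n) <= n)%N.
  have P0 : ((@ord0 n : nat) * K (@ord0 n) <= n)%N by rewrite mul0n.
  rewrite /lev (bigop.bigmax_eq_arg ord0) //.
  by case: arg_maxnP => //= i iK _; split=> //; rewrite -ltnS.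
exists lev; split=> [m n mn|M|n]; last by have [] := lev_attained n.
- by have [? ?] := lev_attained m; apply: le_lev; apply: leq_trans mn.
- by exists (maxn M (M * K M)) => n; rewrite geq_max => /andP[]; exact: le_lev.
Qed.

(* The level grows so slowly that the partial periods at the changes of level
   contribute a vanishing proportion. *)
Lemma slow_periodic_density (R : realType) (L : nat -> nat) :
  (forall m, 0 < L m)%N ->
  exists lev : nat -> nat, forall (P : nat -> nat -> bool) (a : R),
    (fun m => (\sum_(0 <= i < L m) (P m i)%:R) / (L m)%:R : R) @ \oo --> a ->
    density_to [set n | P (lev n) (n %% L (lev n))%N] a.
Proof.
(* The levels depend on the periods alone, so one [lev] serves all patterns [P] and limits [a]. *)
move=> L0; have [lev [lev_mono lev_oo levK]] :=
  slow_levelP (fun m => \sum_(j < m.+1) 2 * L j)%N.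
exists lev => P a; set q := fun m : nat => _ / _; move=> qa.
pose ind n : R := (P (lev n) (n %% L (lev n))%N)%:R.
have q01 m : 0 <= q m <= 1.
  rewrite divr_ge0 ?sumr_ge0 //= ler_pdivrMr ?ltr0n // mul1r.
  apply: (@le_trans _ _ (\sum_(0 <= i < L m) 1)).
    by apply: ler_sum => i _; rewrite lern1 leq_b1.
  by rewrite sumr_const_nat subn0.
have disc N : `|\sum_(0 <= n < N) (ind n - q (lev n))| <=
    (\sum_(j < (lev N).+1) 2 * L j)%:R.
  apply: (@slow_sum_bounded R (fun m n => (P m (n %% L m)%N)%:R - q m)) => //.
  move=> m {}N; apply: periodic_sum_bounded => // [n||n].
  - by rewrite modnDl.
  - rewrite sumrB sumr_const_nat subn0 -mulr_natr /q divfK ?pnatr_eq0 -?lt0n //.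
    apply/eqP; rewrite subr_eq0; apply/eqP/eq_big_nat => i /andP[_ iL].
    by rewrite modn_small.
  - have /andP[q0 q1] := q01 m.
    by case: (P _ _); rewrite ler_norml; apply/andP; split; rewrite /=; lra.
have lev_cvg : lev @ \oo --> \oo.
  move=> U [M _ MU]; have [N NM] := lev_oo M.
  by exists N => // n /= Nn; apply: MU; exact: NM.
have /cesaro mean_q : q \o lev @ \oo --> a by exact: cvg_comp lev_cvg qa.
(* The ratio at [n.+1] is a Cesàro mean of [q \o lev], which tends to [a], plus the discrepancy
   controlled by [disc]. *)
rewrite /density_to -cvg_shiftS; apply/cvgrPdist_lt => e e0.
have e20 : 0 < e / 2 by rewrite divr_gt0.
move/cvgrPdist_lt : mean_q => /(_ _ e20) mean_q.
have [N0 N0P] := lev_oo (Num.truncn (e / 2)^-1).+1.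
near=> n.
have lev_gt : (e / 2)^-1 < (lev n.+1)%:R.
  apply: lt_le_trans (truncnS_gt _) _; rewrite ler_nat; apply: N0P.
  by near: n; exists N0 => // k /= /leqW.
have : `|a - n.+1%:R^-1 * series (q \o lev) n.+1| < e / 2 by near: n.
have lev0 : 0 < (lev n.+1)%:R :> R by apply: lt_trans lev_gt; rewrite invr_gt0.
have n0 : 0 < n.+1%:R :> R by rewrite ltr0n.
rewrite /mk_sequence; set A := [set _ | _].
have -> : density_ratio R A n.+1 = n.+1%:R^-1 * series (q \o lev) n.+1 +
    n.+1%:R^-1 * \sum_(0 <= k < n.+1) (ind k - q (lev k)).
  rewrite -mulrDr sumrB addrC subrK density_ratioE mulrC big_mkord.
  by congr (_ * _); apply: eq_bigr => i _; rewrite /A mem_setE.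
have : `|n.+1%:R^-1 * \sum_(0 <= k < n.+1) (ind k - q (lev k))| < e / 2.
  rewrite normrM ger0_norm ?invr_ge0 ?ler0n // mulrC ltr_pdivrMr //.
  apply: le_lt_trans (disc _) _; rewrite -(ltr_pM2l lev0) -natrM.
  apply: (@le_lt_trans _ _ n.+1%:R); first by rewrite ler_nat.
  rewrite mulrA ltr_pMl // -ltr_pdivrMr // mul1r //.
move: (_ * series _ _) (_ * \sum_(_ <= _ < _) _) => u v.
by rewrite !ltr_norml => /andP[? ?] /andP[? ?]; apply/andP; split; lra.
Unshelve. all: by end_near. Qed.

(** * Averages over finite function spaces *)

Lemma sum_ffun_prod (R : comPzRingType) (J V : finType) (I : Type)
    (s : seq I) (t : I -> J) (g : I -> V -> R) :
  \sum_(w : {ffun J -> V}) \prod_(x <- s) g x (w (t x)) =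
  \prod_j \sum_v \prod_(x <- s | t x == j) g x v.
Proof.
rewrite bigA_distr_bigA /=; apply: eq_bigr => w _.
rewrite (partition_big t xpredT) //=; apply: eq_bigr => j _.
by apply: eq_bigr => x /eqP ->.
Qed.

(** The values of a uniformly random [w] at distinct points are independent. *)
Lemma mean_ffun_prod (R : fieldType) (J V : finType) (I : eqType)
    (s : seq I) (t : I -> J) (g : I -> V -> R) :
  uniq s -> {in s &, injective t} -> #|V|%:R != 0 :> R ->
  (\sum_(w : {ffun J -> V}) \prod_(x <- s) g x (w (t x))) / #|{ffun J -> V}|%:R =
  \prod_(x <- s) ((\sum_v g x v) / #|V|%:R).
Proof.
move=> us tinj V0; rewrite sum_ffun_prod card_ffun natrX.
have -> : #|V|%:R ^+ #|J| = \prod_(j : J) #|V|%:R :> R by rewrite prodr_const.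
rewrite -prodf_div (partition_big t xpredT) //=; apply: eq_bigr => j _.
under eq_bigr do rewrite -big_filter; rewrite -[RHS]big_filter.
have : {in [seq x <- s | t x == j] &, forall x y, x = y}.
  move=> x y; rewrite !mem_filter => /andP[/eqP tx xs] /andP[/eqP ty ys].
  by apply: tinj => //; rewrite tx.
have : uniq [seq x <- s | t x == j] by exact: filter_uniq.
case: [seq x <- s | t x == j] => [_ _|x [_ _|y r]].
- by under eq_bigr do rewrite big_nil; rewrite big_nil sumr_const divff.
- by under eq_bigr do rewrite big_seq1; rewrite big_seq1.
- move=> /= /andP[xyr _] /(_ x y); rewrite !inE !eqxx orbT => /(_ isT isT) xy.
  by rewrite xy mem_head in xyr.
Qed.

Lemma sum_lt_bounds (R : realDomainType) (y : R) (N : nat) :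
  0 <= y <= N%:R ->
  y <= \sum_(i < N) ((val i)%:R < y)%R%:R <= y + 1.
Proof.
move=> /andP[y0 yN].
(* The induction also needs the saturated case: once [y] reaches [N], every index counts. *)
suff [A B] : (y <= N%:R -> y <= \sum_(i < N) ((val i)%:R < y)%R%:R) /\
    (N%:R <= y -> \sum_(i < N) ((val i)%:R < y)%R%:R = N%:R :> R) /\
    \sum_(i < N) ((val i)%:R < y)%R%:R <= y + 1.
  by rewrite A //= B.2.
elim: N {yN} => [|N [IHl [IHe IHu]]]; first by rewrite big_ord0; split => //; split; lra.
rewrite big_ord_recr /= -natr1; case: (ltrP N%:R y) => [Ny|yN].
  by have -> := IHe (ltW Ny); split; [|split]; rewrite /=; lra.
by have := IHl yN; rewrite addr0; split; [|split]; lra.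
Qed.

Lemma cvg_sum_lt (R : realType) (p : R) : 0 <= p <= 1 ->
  (fun m : nat => (\sum_(i < m.+1) ((val i)%:R < p * m.+1%:R)%R%:R) / m.+1%:R : R)
    @ \oo --> p.
Proof.
move=> /andP[p0 p1]; apply: (@squeeze_cvgr _ _ _ _ (cst p)
  (fun m => p + m.+1%:R^-1)); last 2 first.
- exact: cvg_cst.
- rewrite -[X in _ --> X]addr0; apply: cvgD; first exact: cvg_cst.
  exact: cvg_harmonic.
near=> m.
have m0 : 0 < m.+1%:R :> R by rewrite ltr0n.
have := @sum_lt_bounds R (p * m.+1%:R) m.+1.
rewrite mulr_ge0 ?ler0n // ler_piMl ?ler0n // => /(_ isT) /andP[? ?].
rewrite ler_pdivlMr // ler_pdivrMr // mulrDl mulVf ?lt0r_neq0 //.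
by apply/andP.
Unshelve. all: by end_near. Qed.

Lemma cvg_prod_seq (R : realType) (I : Type) (s : seq I) (u : I -> nat -> R)
    (a : I -> R) :
  (forall x, u x @ \oo --> a x) ->
  (fun m => \prod_(x <- s) u x m) @ \oo --> \prod_(x <- s) a x.
Proof.
move=> ua; elim: s => [|x s IHs].
  by under eq_fun do rewrite big_nil; rewrite big_nil; exact: cvg_cst.
under eq_fun do rewrite big_cons; rewrite big_cons; exact: cvgM.
Qed.

(** * An independent family indexed by the sets of naturals *)

Definition truncate (m : nat) (x : set nat) : {ffun 'I_m -> bool} :=
  [ffun i => val i \in x].

Lemma truncate_injective (s : seq (set nat)) :
  exists M, forall m, (M <= m)%N -> {in s &, injective (truncate m)}.
Proof.
(* A place where [x] and [y] differ; the default 0 arises only for [x = y]. Truncations longer than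
   all these places separate the entries of [s]. *)
pose d (x y : set nat) := xget 0%N [set i | (i \in x) != (i \in y)].
exists (\max_(x <- s) \max_(y <- s) (d x y).+1) => m Mm x y xs ys txy.
have dxy : (d x y < m)%N.
  apply: leq_trans Mm.
  apply: leq_trans (leq_bigmax_seq (F := fun x => \max_(y <- s) (d x y).+1) x xs isT).
  exact: (leq_bigmax_seq (F := fun y => (d x y).+1)).
have dE : (d x y \in x) = (d x y \in y).
  by move/ffunP: txy => /(_ (Ordinal dxy)); rewrite !ffunE.
apply: contrapT => xy.
suff : [set i | (i \in x) != (i \in y)] (d x y) by rewrite /= dE eqxx.
apply: xgetPex; apply: contrapT => /forallNP dxyN; apply: xy.
have xyi i : (i \in x) = (i \in y) by apply/eqP/negPn/negP => /dxyN.
by apply/seteqP; split=> i /mem_set; [rewrite xyi|rewrite -xyi] => /set_mem.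
Qed.

(** A uniformly random element gives independent uniform values to distinct truncations; one period
    runs once through all elements. *)
Definition level_type (m : nat) : finType :=
  {ffun {ffun 'I_m -> bool} -> 'I_m.+1}.

Definition level_size (m : nat) : nat := #|level_type m|.

Definition level_nth (m i : nat) : level_type m :=
  nth [ffun=> ord0] (enum (level_type m)) i.

Lemma level_size_gt0 (m : nat) : (0 < level_size m)%N.
Proof. by apply/card_gt0P; exists [ffun=> ord0]. Qed.

(* On level [m], the residue of [n] encodes a function [w] from [{0,1}^m] to
   [{0,...,m}], and [n] belongs to the set indexed by [x] when the value of [w]
   at the truncation of [x] is below [p * (m + 1)]. *)
Definition level_set (R : realType) (lev : nat -> nat) (p : R) (x : set nat) :
    set nat :=
  [set n | (val (level_nth (lev n) (n %% level_size (lev n))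
                  (truncate (lev n) x)))%:R < p * (lev n).+1%:R].

Lemma natr_all (R : pzSemiRingType) (I : Type) (s : seq I) (p : pred I) :
  (all p s)%:R = \prod_(x <- s) (p x)%:R :> R.
Proof.
elim: s => [|x s IHs]; first by rewrite big_nil.
by rewrite big_cons -IHs /= -natrM mulnb.
Qed.

(** Once the level separates the entries of [s], the proportion within a period is the product of
    the proportions of values below [f x * m.+1%:R], and each factor tends to [f x]. *)
Lemma level_set_density (R : realType) : exists lev : nat -> nat,
  forall (f : set nat -> R) (s : seq (set nat)),
    (forall x, 0 <= f x <= 1) -> uniq s ->
    density_to (\bigcap_(x in [set` s]) level_set lev (f x) x) (\prod_(x <- s) f x).
Proof.
have [lev levP] := @slow_periodic_density R level_size level_size_gt0.
exists lev => f s f01 us.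
pose p m x (w : level_type m) := (val (w (truncate m x)))%:R < f x * m.+1%:R.
have -> : \bigcap_(x in [set` s]) level_set lev (f x) x =
    [set n | all (fun x => p (lev n) x
      (level_nth (lev n) (n %% level_size (lev n)))) s].
  apply/seteqP; split=> n /=; first by move=> sn; apply/allP => x /sn.
  by move=> /allP sn x /= /sn.
apply: (levP (fun m i => all (fun x => p m x (level_nth m i)) s)).
have := @cvg_prod_seq R _ s (fun x m =>
  (\sum_(i < m.+1) ((val i)%:R < f x * m.+1%:R)%R%:R) / m.+1%:R) f
  (fun x => cvg_sum_lt (f01 x)).
have [M MP] := truncate_injective s.
apply: cvg_trans; apply: near_eq_cvg; near=> m.
have tinj : {in s &, injective (truncate m)}.
  by near: m; exists M => // m /= /MP.
have -> : \sum_(0 <= i < level_size m)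
      (all (fun x => p m x (level_nth m i)) s)%:R =
    \sum_(w : level_type m) \prod_(x <- s) (p m x w)%:R :> R.
  rewrite -[RHS]big_enum (big_nth [ffun=> ord0]) -cardE.
  by apply: eq_bigr => i _; rewrite natr_all.
have V0 : #|'I_m.+1|%:R != 0 :> R by rewrite card_ord pnatr_eq0.
rewrite (mean_ffun_prod
  (fun x (v : 'I_m.+1) => ((val v)%:R < f x * m.+1%:R)%R%:R) us tinj V0).
by rewrite card_ord.
Unshelve. all: by end_near. Qed.

(** Rational cuts embed the reals into the sets of naturals; [f] inverts this embedding on [S] and
    takes the value [s0] elsewhere. *)
Lemma surjection_from_set_nat (R : realType) (S : set R) :
  S !=set0 -> exists f : set nat -> R, range f = S.
Proof.
move=> [s0 Ss0].
pose cut (s : R) : set nat :=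
  [set n | exists2 q : rat, choice.pickle q = n & ratr q < s].
have cut_le s t : cut s = cut t -> t <= s.
  move=> st; rewrite leNgt; apply/negP => lt_st.
  have [q] := rat_in_itvoo lt_st; rewrite in_itv /= => /andP[sq qt].
  have : cut t (choice.pickle q) by exists q.
  rewrite -st => -[q' /(pcan_inj (@choice.pickleK _)) ->].
  by rewrite ltNge (ltW sq).
have cut_inj s t : cut s = cut t -> s = t.
  by move=> st; apply/le_anti/andP; split; apply: cut_le.
pose f x := xget s0 [set s | S s /\ cut s = x].
exists f; apply/seteqP; split=> [_ [x _ <-]|s Ss].
  by rewrite /f; case: xgetP => // y _ [].
exists (cut s) => //; rewrite /f; case: xgetP => [y _ [_ /cut_inj]//|].
by move=> /(_ s); case.
Qed.

Lemma independent_continuum (R : realType) (S : set R) :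
  S !=set0 -> S `<=` [set x | 0 < x < 1] ->
  exists A : set (set nat),
    [/\ independent S A, density R @` A = S & A #= [set: set nat]].
Proof.
move=> S0 S01; have [f fS] := surjection_from_set_nat S0.
have fS' x : S (f x) by rewrite -fS; exists x.
have [lev levP] := level_set_density R.
pose L x := level_set lev (f x) x.
have f01 x : 0 <= f x <= 1 by have /andP[? ?] := S01 _ (fS' x); rewrite !ltW.
have densL s : uniq s ->
    density_to (\bigcap_(x in [set` s]) L x) (\prod_(x <- s) f x).
  exact: levP.
have dens1 x : density_to (L x) (f x).
  have := densL [:: x] isT; rewrite big_seq1.
  by rewrite set_cons1 bigcap_set1.
have Ldens x : density R (L x) = f x by exact: density_to_density.
(* If distinct [x] and [y] gave the same set, then [f x = f x * f y], hence [f y = 1]. *)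
have Linj : injective L.
  move=> x y Lxy; apply/eqP/negPn/negP => xy.
  have := densL [:: x; y]; rewrite /= inE xy /= => /(_ isT) /density_to_density.
  have -> : \bigcap_(z in [set` [:: x; y]]) L z = L x.
    apply/seteqP; split=> [n|n Ln z]; first by apply; rewrite /= mem_head.
    by rewrite /= !inE => /orP[/eqP ->|/eqP ->] //; rewrite -Lxy.
  have /andP[x0 _] := S01 _ (fS' x); have /andP[_ y1] := S01 _ (fS' y).
  rewrite Ldens !big_cons big_nil mulr1 => /eqP.
  rewrite -{1}[f x]mulr1 => /eqP /(mulfI (lt0r_neq0 x0)) fy1.
  by rewrite -fy1 ltxx in y1.
exists (range L); split.
- split=> [_ [x _ <-]|F finF FL]; first by rewrite Ldens.
  (* Chosen indices turn [F] into a duplicate-free sequence to which [densL] applies. *)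
  pose g X := xget set0 [set x | L x = X].
  have gK X : F X -> L (g X) = X.
    by move=> /FL[x _ Lx]; rewrite /g; case: xgetP => // /(_ x).
  have [s Fs] := (finite_seqP F).1 finF.
  have us : uniq (map g (undup s)).
    rewrite map_inj_in_uniq ?undup_uniq // => X Y.
    rewrite !mem_undup => Xs Ys gXY.
    by rewrite -[X]gK ?Fs // gXY gK ?Fs.
  have -> : \bigcap_(X in F) X = \bigcap_(x in [set` map g (undup s)]) L x.
    apply/seteqP; split=> n Fn.
      move=> x /= /mapP[X]; rewrite mem_undup => Xs ->.
      by rewrite gK ?Fs //; apply: Fn; rewrite Fs.
    move=> X FX; rewrite -[X]gK //; apply: Fn.
    by rewrite /= map_f // mem_undup; move: FX; rewrite Fs.
  rewrite setTI mul1r.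
  have -> : \big[*%R/1]_(X \in F) density R X = \prod_(x <- map g (undup s)) f x.
    have -> : F = [set` undup s].
      by rewrite Fs; apply/seteqP; split=> X /=; rewrite mem_undup.
    rewrite -fsbig_seq ?undup_uniq // big_map big_seq [RHS]big_seq.
    apply: eq_bigr => X; rewrite mem_undup => Xs.
    by rewrite -Ldens gK // Fs.
  exact: densL.
- by rewrite image_comp; have -> : density R \o L = f by exact/funext.
- by apply: inj_card_eq => x y _ _; exact: Linj.
Qed.

(** * Assembly of the maximal family and its countable part *)

Unset Implicit Arguments.

Theorem theorem2p6 (R : realType) (S : set R)
    (S_nonempty : S !=set0) (S_sub : S `<=` [set x | 0 < x < 1]) :
  exists A B : set (set nat),
    [/\ maximal_d_independent R A /\ A #= [set: set nat],
        B `<=` A /\ countable B,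
        density R @` (A `\` B) = S
      & limit_point (density R @` B) `<=` [set 0; 1]].
Proof.
have [A0 [indA0 A0S cardA0]] := independent_continuum S_nonempty S_sub.
have [A [A0A indA maxA]] := independent_maximal indA0.
have indA01 : independent [set x : R | 0 < x < 1] A by exact: independentS indA.
have [M [AM indM maxM]] := independent_maximal indA01.
have [s Ss] := S_nonempty.
have finB e : 0 < e -> finite_set
    [set X | (M `\` A) X /\ e <= density R X <= 1 - e].
  by move=> e0; exact: (maximal_extension_finite S_sub Ss).
have M01 X : (M `\` A) X -> 0 < density R X < 1 by case=> /(indM.1).
exists M, (M `\` A); split.
- split; last first.
    rewrite card_eq_le card_leT /= -(card_le_eql cardA0).
    by apply: subset_card_le; exact: subset_trans AM.
  split.
    apply/d_independentP; split => //.
    move: S_nonempty; rewrite -A0S => -[_ [X A0X _]].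
    by exists X; apply/AM/A0A.
  move=> [H [/d_independentP[_ indH] [MH HM]]]; apply: HM.
  exact: maxM.
- split; first exact: subDsetl.
  (* Every density in the open unit interval lies in [[1/(n+1), 1 - 1/(n+1)]] for some [n], so
     [M]\[A] is covered by countably many finite sets. *)
  apply: (@sub_countable _ _ _ (\bigcup_n [set X | (M `\` A) X /\
      (n.+1%:R : R)^-1 <= density R X <= 1 - n.+1%:R^-1])).
    apply: subset_card_le => X MAX.
    have /andP[d0 d1] := M01 _ MAX.
    pose e := Num.min (density R X) (1 - density R X).
    have e0 : 0 < e by rewrite lt_min d0 subr_gt0.
    exists (Num.truncn e^-1) => //; split=> //.
    have : (Num.truncn e^-1).+1%:R^-1 < e.
      by rewrite invf_plt ?posrE ?ltr0n // truncnS_gt.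
    by rewrite lt_min ltrBrDl -ltrBrDr => /andP[/ltW -> /ltW].
  apply: bigcup_countable => [|n _]; first exact: countableP.
  by apply/finite_set_countable/finB; rewrite invr_gt0 ltr0n.
- suff -> : M `\` (M `\` A) = A.
    apply/seteqP; split=> [_ [X /(indA.1) SX <-]//|x]; rewrite -A0S.
    by move=> [X /A0A AX <-]; exists X.
  by rewrite setDD; exact: setIidr.
- move=> p /limit_point_infinite_setP plim; apply: contrapT => /not_orP[/eqP p0 /eqP p1].
  (* Half the distance from [p] to the nearer of 0 and 1: densities of extra sets within [e] of [p]
     lie in [[e, 1 - e]], so there are finitely many, also when [p] is outside the unit interval. *)
  pose e := Num.min `|p| `|1 - p| / 2.
  have e0 : 0 < e by rewrite divr_gt0 // lt_min !normr_gt0 p0 subr_eq0 eq_sym.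
  apply: (plim (ball p e)); first exact: nbhsx_ballx.
  apply: sub_finite_set (finite_image (density R) (finB e e0)).
  move=> y [+ [X MAX yX]]; rewrite -yX -ball_normE /= => pX.
  exists X => //; split=> //; have /andP[d0 d1] := M01 _ MAX.
  have ep : e * 2 <= `|p| by rewrite divfK // ge_min lexx.
  have ep1 : e * 2 <= `|1 - p| by rewrite divfK // ge_min lexx orbT.
  move: pX ep ep1; rewrite ltr_norml => /andP[? ?].
  by case: ler0P => ? ?; case: ler0P => ? ?; apply/andP; split; lra.
Qed.
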